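(* Let $k \geq l$ be positive integers with $k \geq 2$, and let $A \subset \mathbb{N}$ be such that the set $A^k + A^l$ has positive lower density. Then there is a constant $C>0$ such that for infinitely many positive integers $X$, $$A(X) \geq C\,\frac{\sqrt{X}}{(\log X)^{\alpha(k,l)}}, \qquad \text{where } \alpha(k,l) = \frac{k+l-2}{k+l}.$$
   Context: $\mathbb{N}$ denotes the set of positive integers. For sets $A,B$ of integers, $AB=\{ab: a\in A, b\in B\}$, $A+B=\{a+b: a\in A,b\in B\}$, $A^1=A$ and $A^k = A A^{k-1}$ for $k>1$. For $A\subset\mathbb{N}_0$ and $X>0$, $A(X)=|A\cap[1,X]|$. The lower density of $A$ is $\liminf_{X\to\infty} A(X)/X$. *)

(* Defs.v *)
From HB Require Import structures.
From mathcomp Require Import all_boot all_order all_algebra.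
From mathcomp Require Import all_classical all_reals all_analysis.
Set Implicit Arguments. Unset Strict Implicit. Unset Printing Implicit Defensive.
Import Order.TTheory GRing.Theory Num.Theory.
Local Open Scope classical_set_scope.
Local Open Scope ring_scope.

Definition prodset (A B : set nat) : set nat :=
  [set n | exists a b, A a /\ B b /\ n = (a * b)%N].

Definition sumset (A B : set nat) : set nat :=
  [set n | exists a b, A a /\ B b /\ n = (a + b)%N].

Fixpoint prodpow (A : set nat) (k : nat) : set nat :=
  match k with
  | 0 => [set 1%N]
  | k'.+1 => prodset A (prodpow A k')
  end.

Definition countA (A : set nat) (X : nat) : nat :=
  \sum_(1 <= n < X.+1) (n \in A : nat).

Definition lower_density (R : realType) (A : set nat) : R :=
  limn_inf (fun X : nat => (countA A X)%:R / X%:R).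

(* Main.v *)
(* Put p = 2 / (k + l), so that alpha = 1 - p. If the conclusion fails, then
   A(X) = o(sqrt X / (log X)^(1 - p)), hence A has o(2^m m^(p - 1)) elements in
   the block [4^m, 4^(m + 1)). A product of elements of the blocks i and j lies
   in block i + j or i + j + 1, and the convolution of i^(p - 1) and j^(q - 1)
   is O(m^(p + q - 1)) for p, q > 0 (a discrete beta integral); so A^j has
   O(2^m m^(j p - 1)) elements in block m, with o for O thanks to the bound on
   A. Summing over the blocks, A^k and A^l have together at most
   A^k(4^n) A^l(4^n) = o(4^n n^((k + l) p - 2)) = o(4^n) pairs of elements up to
   4^n, so A^k + A^l has lower density 0.

   The estimate o(v) for a block is expressed as: for every e > 0 it is at most
   e v + M v', where v' has an exponent of m smaller by p / 2; this form is
   preserved by convolution. *)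
Require Import Defs.
From HB Require Import structures.
From mathcomp Require Import all_boot all_order all_algebra.
From mathcomp Require Import all_classical all_reals all_analysis.
From mathcomp Require Import zify ring lra.
Import Order.TTheory GRing.Theory Num.Theory.
Local Open Scope classical_set_scope.
Local Open Scope ring_scope.

(** * Counting elements in blocks between powers of 4 *)

Definition elems (S : set nat) (a b : nat) : seq nat :=
  [seq n <- index_iota a b | n \in S].

Definition block (S : set nat) (m : nat) : seq nat := elems S (4 ^ m) (4 ^ m.+1).

Lemma mem_elems (S : set nat) (a b n : nat) :
  (n \in elems S a b) = (n \in S) && (a <= n < b)%N.
Proof. by rewrite mem_filter mem_index_iota. Qed.

Lemma uniq_elems (S : set nat) (a b : nat) : uniq (elems S a b).
Proof. exact/filter_uniq/iota_uniq. Qed.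

Lemma countAE (S : set nat) (X : nat) : countA S X = size (elems S 1 X.+1).
Proof.
rewrite size_filter -sum1_count [RHS]big_mkcond; apply: eq_bigr => i _.
by case: (i \in S).
Qed.

Lemma countA_le (S : set nat) (X : nat) : (countA S X <= X)%N.
Proof.
rewrite countAE (leq_trans (size_subseq (filter_subseq _ _)))//.
by rewrite size_iota subn1.
Qed.

Lemma size_block_le_countA (S : set nat) (m : nat) :
  (size (block S m) <= countA S (4 ^ m.+1))%N.
Proof.
rewrite countAE; apply: uniq_leq_size (uniq_elems _ _ _) _ => n.
rewrite !mem_elems => /andP[-> /andP[mn nm]] /=.
by rewrite ltnS (ltnW nm) andbT (leq_trans _ mn)// expn_gt0.
Qed.

(** The block [n] is included because it contains the endpoint [4 ^ n]. *)
Lemma countA_le_sum_block (S : set nat) (n : nat) :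
  (countA S (4 ^ n) <= \sum_(m < n.+1) size (block S m))%N.
Proof.
rewrite countAE -(big_mkord xpredT (fun m => size (block S m))).
have -> : (\sum_(0 <= m < n.+1) size (block S m))%N =
    size (flatten [seq block S m | m <- index_iota 0 n.+1]).
  by rewrite size_flatten sumnE !big_map.
apply: uniq_leq_size (uniq_elems _ _ _) _ => x.
rewrite mem_elems ltnS => /andP[Sx /andP[x0 xn]].
have /andP[tx xt] := trunc_log_bounds (isT : (1 < 4)%N) x0.
apply/flatten_mapP; exists (trunc_log 4 x); last by rewrite mem_elems Sx tx.
by rewrite mem_index_iota /= ltnS -(@leq_exp2l 4)// (leq_trans tx).
Qed.

(** For [x] in block [i] and [y] in block [j], the product satisfies
    [4 ^ (i + j) <= x * y < 4 ^ (i + j + 2)], so [m] is [i + j] or [i + j + 1]. The two sums count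
    the pairs of these two kinds; for [m = 0] the second sum is empty, so the truncated [m.-1] does
    no harm. *)
Lemma size_block_prodset (S T : set nat) (m : nat) :
  (size (block (prodset S T) m) <=
   \sum_(i < m.+1) size (block S i) * size (block T (m - i)) +
   \sum_(i < m) size (block S i) * size (block T (m.-1 - i)))%N.
Proof.
pose pairs (r n : nat) := flatten
  [seq [seq (x * y)%N | x <- block S i, y <- block T (n - i)] | i <- iota 0 r].
have szE r n : size (pairs r n) =
    (\sum_(i < r) size (block S i) * size (block T (n - i)))%N.
  rewrite size_flatten sumnE !big_map -[r in iota 0 r]subn0 big_mkord.
  by apply: eq_bigr => i _; rewrite size_allpairs.
have pairsP r n i x y : (i < r)%N -> x \in block S i ->
    y \in block T (n - i) -> (x * y)%N \in pairs r n.
  move=> ir xi yn; apply/flatten_mapP; exists i; first by rewrite mem_iota.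
  exact: allpairs_f.
rewrite -!szE -size_cat; apply: uniq_leq_size (uniq_elems _ _ _) _ => z.
rewrite mem_elems => /andP[/set_mem[x [y [Sx [Ty ->]]]] /andP[mz zm]].
have : (0 < x * y)%N by rewrite (leq_trans _ mz)// expn_gt0.
rewrite muln_gt0 => /andP[x0 y0].
have [i [xi1 xi2]] : exists i, (4 ^ i <= x /\ x < 4 ^ i.+1)%N.
  by exists (trunc_log 4 x); apply/andP/trunc_log_bounds.
have [j [yj1 yj2]] : exists j, (4 ^ j <= y /\ y < 4 ^ j.+1)%N.
  by exists (trunc_log 4 y); apply/andP/trunc_log_bounds.
have xi : x \in block S i by rewrite mem_elems (mem_set Sx) xi1.
have yj : y \in block T j by rewrite mem_elems (mem_set Ty) yj1.
have ijm : (i + j < m.+1)%N.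
  by rewrite -(@ltn_exp2l 4)// expnD (leq_ltn_trans _ zm)// leq_mul.
have mij : (m < i.+1 + j.+1)%N.
  by rewrite -(@ltn_exp2l 4)// expnD (leq_ltn_trans mz)// ltn_mul.
rewrite mem_cat; have [ij|ij] := eqVneq (i + j)%N m.
  apply/orP; left; apply: (pairsP _ _ i) => //; first by lia.
  by rewrite -ij addKn.
apply/orP; right; apply: (pairsP _ _ i) => //; first by lia.
by rewrite (_ : (m.-1 - i)%N = j)//; lia.
Qed.

(** Positive summands of a number up to [X] both lie in [[1, X]], and a sum is determined by its
    pair of summands. *)
Lemma countA_sumset (S T : set nat) (X : nat) :
  S `<=` [set n | (0 < n)%N] -> T `<=` [set n | (0 < n)%N] ->
  (countA (sumset S T) X <= countA S X * countA T X)%N.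
Proof.
move=> S0 T0; rewrite !countAE -(size_allpairs addn).
apply: uniq_leq_size (uniq_elems _ _ _) _ => z.
rewrite mem_elems => /andP[/set_mem[x [y [Sx [Ty ->]]]] /andP[_ zX]].
have x0 : (0 < x)%N := S0 _ Sx; have y0 : (0 < y)%N := T0 _ Ty.
by apply: allpairs_f; rewrite mem_elems mem_set//=; lia.
Qed.

Lemma prodpow1 (A : set nat) : prodpow A 1 = A.
Proof.
apply/seteqP; split => n /=.
  by move=> [a [b [Aa [-> ->]]]]; rewrite muln1.
by move=> An; exists n, 1%N; rewrite muln1.
Qed.

Lemma prodpow_gt0 (A : set nat) (k : nat) :
  A `<=` [set n | (0 < n)%N] -> prodpow A k `<=` [set n | (0 < n)%N].
Proof.
move=> A0; elim: k => [|k IHk] n /=; first by move=> ->.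
by move=> [a [b [/A0 a0 [/IHk b0 ->]]]]; rewrite muln_gt0 a0.
Qed.

(** The lower limit is the supremum of the infima of the tails, so one of these infima is already
    positive; it serves as [d]. *)
Lemma lower_density_gt0 (R : realType) (S : set nat) :
  0 < lower_density R S ->
  exists2 d : R, 0 < d &
    exists N, forall X, (N <= X)%N -> d * X%:R <= (countA S X)%:R.
Proof.
set u := fun X : nat => (countA S X)%:R / X%:R : R.
have u01 X : 0 <= u X <= 1.
  (* At [X = 0] the quotient is 0, by the convention that the inverse of 0 is 0. *)
  rewrite /u divr_ge0//=; case: X => [|X]; first by rewrite invr0 mulr0.
  by rewrite ler_pdivrMr ?ltr0n// mul1r ler_nat countA_le.
have lbu : has_lbound (range u).
  by exists 0 => _ [X _ <-]; have /andP[] := u01 X.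
have ubu : has_ubound (range u).
  by exists 1 => _ [X _ <-]; have /andP[] := u01 X.
have infs_cvg := cvg_infs_sup ubu lbu.
rewrite /lower_density /limn_inf (cvg_lim _ infs_cvg)// => s0.
have rng : range (infs u) !=set0 by exists (infs u 0%N), 0%N.
have [_ [N _ <-] dN] := sup_gt rng s0.
(* The successor makes [X] positive, so that the quotient can be cleared. *)
exists (infs u N) => //; exists N.+1 => X NX.
have X0 : (0 : R) < X%:R by rewrite ltr0n; lia.
rewrite -ler_pdivlMr//; apply: ge_inf.
  by exists 0 => _ [Y _ <-]; have /andP[] := u01 Y.
by exists X => //=; lia.
Qed.

(** * The weights [wt] and [env]: partial sums and convolutions *)

(* If [A] counts [sqrt X / (log X)^(1 - p)] elements up to [X], then [env R p m]
   is the order of magnitude of the size of [block A m]. *)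
Definition wt (R : realType) (p : R) (m : nat) : R := m.+1%:R `^ (p - 1).

Definition env (R : realType) (p : R) (m : nat) : R := 2 ^+ m * wt R p m.

Lemma wt_gt0 (R : realType) (p : R) (m : nat) : 0 < wt R p m.
Proof. by rewrite powR_gt0. Qed.

Lemma wt_ge0 (R : realType) (p : R) (m : nat) : 0 <= wt R p m.
Proof. exact: powR_ge0. Qed.

Lemma env_gt0 (R : realType) (p : R) (m : nat) : 0 < env R p m.
Proof. by rewrite mulr_gt0 ?wt_gt0// exprn_gt0. Qed.

Lemma wtM (R : realType) (p q : R) (m : nat) :
  wt R p m * wt R q m = m.+1%:R `^ (p + q - 2).
Proof.
rewrite -powRD; last by rewrite pnatr_eq0 implybT.
by congr (_ `^ _); ring.
Qed.

Lemma wtD (R : realType) (p q : R) (m : nat) :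
  wt R (p + q) m = m.+1%:R `^ p * wt R q m.
Proof.
rewrite -powRD; last by rewrite pnatr_eq0 implybT.
by rewrite /wt -addrA.
Qed.

(** The factor [2 ^+ m] is at least [m + 1], and the weight is at least [1 / (m + 1)]. *)
Lemma env_ge1 (R : realType) (p : R) (m : nat) : 0 <= p -> 1 <= env R p m.
Proof.
move=> p0; have m1 : (1 : R) <= m.+1%:R by rewrite ler1n.
apply: (@le_trans _ _ (m.+1%:R * m.+1%:R `^ (- 1))).
  by rewrite powR_inv1// divff.
apply: ler_pM; rewrite ?powR_ge0//; last by apply: ler_powR => //; lra.
by rewrite -natrX ler_nat ltn_expl.
Qed.

(* With [x = 1 / (i + 1)]: [(1 - x)^p <= exp (- p x) <= 1 / (1 + p x)], and
   [p x <= p] makes the last term at most [1 - p x / (1 + p)]. *)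
Lemma wt_le_diff (R : realType) (p : R) (i : nat) : 0 < p ->
  p / (1 + p) * wt R p i <= i.+1%:R `^ p - i%:R `^ p.
Proof.
move=> p0; have p1 : 0 < 1 + p by lra.
set y := i.+1%:R : R; have y0 : 0 < y by rewrite ltr0n.
have y1 : 1 <= y by rewrite ler1n.
have yE : y `^ p = y * wt R p i by rewrite mulr_powRB1// ltW.
pose x := y^-1; have x0 : 0 < x by rewrite invr_gt0.
have x1 : x <= 1 by rewrite invf_le1.
have key : (1 - x) `^ p <= 1 - p / (1 + p) * x.
  have rhs : (1 + p * x)^-1 <= 1 - p / (1 + p) * x.
    have px : 0 < 1 + p * x by nra.
    rewrite -[_^-1]mul1r ler_pdivrMr//.
    rewrite [leRHS](_ : _ = 1 + p ^+ 2 * x * (1 - x) / (1 + p)); last first.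
      by field; lra.
    rewrite lerDl; apply: divr_ge0; last exact: ltW.
    by apply: mulr_ge0; [rewrite mulr_ge0 ?sqr_ge0// ltW | lra].
  apply: le_trans rhs; have px : 0 < 1 + p * x by nra.
  (* The case [i = 0] is separate: the power of 0 is not given by the exponential of a logarithm. *)
  have [x1'|x1'] := eqVneq (1 - x) 0.
    by rewrite x1' powR0 ?gt_eqF// invr_ge0 ltW.
  have x1lt : 0 < 1 - x by rewrite lt_neqAle eq_sym x1'; lra.
  rewrite /powR (negbTE x1').
  apply: (@le_trans _ _ (expR (- (p * x)))).
    rewrite ler_expR -mulrN ler_pM2l//.
    by apply: le_ln1Dx; lra.
  by rewrite expRN lef_pV2 ?posrE ?expR_gt0// expR_ge1Dx.
have iE : i%:R = y * (1 - x) :> R.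
  by rewrite mulrBr mulr1 divff ?gt_eqF// /y -natr1 addrK.
rewrite iE powRM ?(ltW y0)//; last by lra.
rewrite -[X in X - _]mulr1 -mulrBr yE.
apply: (@le_trans _ _ (y * wt R p i * (p / (1 + p) * x))); last first.
  by rewrite ler_pM2l ?mulr_gt0 ?wt_gt0//; lra.
rewrite [leRHS](_ : _ = y * x * (p / (1 + p) * wt R p i)); last by ring.
by rewrite divff ?gt_eqF// mul1r.
Qed.

(** The bound of [wt_le_diff] telescopes. *)
Lemma sum_wt_le (R : realType) (p : R) (n : nat) : 0 < p ->
  \sum_(i < n) wt R p i <= (1 + p) / p * n%:R `^ p.
Proof.
move=> p0; have c0 : 0 < p / (1 + p) by rewrite divr_gt0//; lra.
rewrite -[(1 + p) / p]invf_div mulrC ler_pdivlMr// mulrC.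
elim: n => [|n IHn]; first by rewrite big_ord0 mulr0 powR_ge0.
by rewrite big_ord_recr mulrDr/= -lerBrDr (le_trans IHn)//
   lerBrDr -lerBrDl wt_le_diff.
Qed.

Lemma powR_two_ge1 (R : realType) (x : R) : 0 <= x -> 1 <= 2 `^ x.
Proof.
move=> x0; have le12 : (1 : R) <= 2 by rewrite ler1n.
by have := ler_powR le12 x0; rewrite powRr0.
Qed.

(** For an exponent [p - 1 >= 0] the weight is monotone; for a negative one, passing from [m] to [n]
    loses at most the factor [2 ^ (1 - p)]. *)
Lemma wt_half (R : realType) (p : R) : exists2 D : R, 0 < D &
  forall m n, (m <= n)%N -> (n.+1 <= 2 * m.+1)%N -> wt R p m <= D * wt R p n.
Proof.
exists (2 `^ `|p - 1|) => [|m n mn nm]; first by rewrite powR_gt0.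
rewrite /wt; set e := p - 1.
have [e0|e0] := leP 0 e.
  apply: (@le_trans _ _ (n.+1%:R `^ e)).
    by apply: ge0_ler_powR; rewrite ?nnegrE// ler_nat.
  by rewrite ler_peMl ?powR_ge0// powR_two_ge1.
rewrite ltr0_norm//; have [f fE] : exists f, e = - f by exists (- e); rewrite opprK.
rewrite fE opprK !powRN.
rewrite ler_pdivlMr ?powR_gt0// mulrC ler_pdivrMr ?powR_gt0//.
rewrite -powRM//; apply: ge0_ler_powR; rewrite ?nnegrE// ?mulr_ge0//.
  by lra.
by rewrite -natrM ler_nat.
Qed.

(* One of the two indices is at least [n / 2], and its weight is comparable
   to that of [n]. *)
Lemma conv_wt_le (R : realType) (p q : R) : 0 < p -> 0 < q ->
  exists2 K : R, 0 < K & forall n,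
    \sum_(i < n.+1) wt R p i * wt R q (n - i) <= K * wt R (p + q) n.
Proof.
move=> p0 q0.
have [Dp Dp0 DpP] := wt_half R p; have [Dq Dq0 DqP] := wt_half R q.
exists (Dq * ((1 + p) / p) + Dp * ((1 + q) / q)).
  by rewrite addr_gt0// mulr_gt0// divr_gt0//; lra.
move=> n.
have sumrev : \sum_(i < n.+1) wt R q (n - i) = \sum_(i < n.+1) wt R q i.
  by rewrite (reindex_inj rev_ord_inj)/=; apply: eq_bigr => i _;
     rewrite subSS subKn// -ltnS.
apply: (@le_trans _ _ (\sum_(i < n.+1)
    (Dq * wt R q n * wt R p i + Dp * wt R p n * wt R q (n - i)))).
  apply: ler_sum => i _; have := ltn_ord i; rewrite ltnS => i_n.
  have [h|h] := leqP (2 * i) n.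
    rewrite -[leLHS]addr0; apply: lerD.
      by rewrite mulrC ler_wpM2r ?wt_ge0// ?DpP ?DqP//; lia.
    exact: mulr_ge0 (mulr_ge0 (ltW Dp0) (wt_ge0 _ _ _)) (wt_ge0 _ _ _).
  rewrite -[leLHS]add0r; apply: lerD.
    exact: mulr_ge0 (mulr_ge0 (ltW Dq0) (wt_ge0 _ _ _)) (wt_ge0 _ _ _).
  by rewrite ler_wpM2r ?wt_ge0// ?DpP ?DqP//; lia.
rewrite big_split/= -!mulr_sumr sumrev mulrDl; apply: lerD.
  apply: le_trans (ler_wpM2l _ (sum_wt_le R p n.+1 p0)) _.
    exact: mulr_ge0 (ltW Dq0) (wt_ge0 _ _ _).
  by rewrite wtD le_eqVlt; apply/orP; left; apply/eqP; ring.
apply: le_trans (ler_wpM2l _ (sum_wt_le R q n.+1 q0)) _.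
  exact: mulr_ge0 (ltW Dp0) (wt_ge0 _ _ _).
by rewrite (addrC p q) wtD le_eqVlt; apply/orP; left; apply/eqP; ring.
Qed.

(** The powers of 2 in each sum multiply to a constant, which leaves a convolution of weights. The
    second sum is the convolution at [n - 1], brought back to [n] by [wt_half]. *)
Lemma conv_env_le (R : realType) (p q : R) : 0 < p -> 0 < q ->
  exists2 K : R, 0 < K & forall n,
    \sum_(i < n.+1) env R p i * env R q (n - i) +
    \sum_(i < n) env R p i * env R q (n.-1 - i) <= K * env R (p + q) n.
Proof.
move=> p0 q0; have [K K0 KP] := conv_wt_le R p q p0 q0.
have convE n : \sum_(i < n.+1) env R p i * env R q (n - i) =
    2 ^+ n * \sum_(i < n.+1) wt R p i * wt R q (n - i).
  rewrite mulr_sumr; apply: eq_bigr => i _.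
  by rewrite /env mulrACA -exprD subnKC// -ltnS.
have conv_le n : \sum_(i < n.+1) env R p i * env R q (n - i) <=
    K * env R (p + q) n.
  by rewrite convE /env mulrCA ler_pM2l ?exprn_gt0.
have [D D0 DP] := wt_half R (p + q).
exists (K + K * D); first by rewrite addr_gt0// mulr_gt0.
move=> n; rewrite mulrDl lerD//; case: n => [|n].
  rewrite big_ord0.
  exact: mulr_ge0 (mulr_ge0 (ltW K0) (ltW D0)) (ltW (env_gt0 _ _ _)).
rewrite (le_trans (conv_le n))// -mulrA ler_pM2l// /env mulrCA.
apply: ler_pM; rewrite ?exprn_ge0// ?wt_ge0//.
  by rewrite ler_eXn2l// ?ltr1n.
by apply: DP; lia.
Qed.

(* The ratio of the weights of [m] and [n] is at most [n - m + 1], which the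
   geometric factor absorbs. *)
Lemma sum_env_le (R : realType) (p : R) (n : nat) : 0 <= p ->
  \sum_(m < n.+1) env R p m <= 4 * env R p n.
Proof.
move=> p0.
have wt_le m : (m <= n)%N -> wt R p m <= (n - m).+1%:R * wt R p n.
  move=> mn; have [p1|p1] := leP 1 p.
    apply: (@le_trans _ _ (wt R p n)).
      by apply: ge0_ler_powR; rewrite ?nnegrE ?subr_ge0// ler_nat.
    by rewrite ler_peMl ?wt_ge0// ler1n.
  rewrite /wt -[p - 1]opprK opprB !(powRN _ (1 - p)).
  rewrite ler_pdivlMr ?powR_gt0// mulrC ler_pdivrMr ?powR_gt0//.
  apply: (@le_trans _ _ (((n - m).+1%:R * m.+1%:R) `^ (1 - p))).
    apply: ge0_ler_powR; rewrite ?nnegrE ?mulr_ge0 ?subr_ge0 ?(ltW p1)//.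
    by rewrite -natrM ler_nat; nia.
  rewrite powRM// ler_wpM2r ?powR_ge0// ler1_powR ?ler1n//; lra.
have geom N : (\sum_(m < N.+1) 2 ^ m * (N - m).+1 <= 4 * 2 ^ N)%N.
  (* The induction runs on the exact value of the sum. *)
  suff : (\sum_(m < N.+1) 2 ^ m * (N - m).+1 + N + 3 = 4 * 2 ^ N)%N by lia.
  elim: N => [|N IHN]; first by rewrite big_ord1.
  rewrite big_ord_recl expnS (mulnCA 4) -IHN /= /bump.
  under eq_bigr => i _ do rewrite add1n expnS subSS -mulnA.
  by rewrite -big_distrr /= expn0 subn0; lia.
apply: (@le_trans _ _ (\sum_(m < n.+1) (2 ^ m * (n - m).+1)%:R * wt R p n)).
  apply: ler_sum => m _; rewrite natrM natrX -mulrA ler_pM2l ?exprn_gt0//.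
  by rewrite wt_le// -ltnS.
rewrite -mulr_suml -natr_sum mulrA ler_pM2r ?wt_gt0//.
by rewrite -natrX -natrM ler_nat geom.
Qed.

(** * Block sizes of product sets *)

Lemma block_prodset_le (R : realType) (p p' q : R) :
  0 < p -> 0 < p' -> 0 < q -> exists2 K : R, 0 < K &
  forall (S T : set nat) (a b c : R), 0 <= a -> 0 <= b -> 0 <= c ->
    (forall m, (size (block S m))%:R <= a * env R p m + b * env R p' m) ->
    (forall m, (size (block T m))%:R <= c * env R q m) ->
    forall m, (size (block (prodset S T) m))%:R <=
      K * c * (a * env R (p + q) m + b * env R (p' + q) m).
Proof.
move=> p0 p'0 q0.
have [K1 K10 K1P] := conv_env_le R p q p0 q0.
have [K2 K20 K2P] := conv_env_le R p' q p'0 q0.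
(* The constant depends on the exponents alone, so the coefficient [a] may later be chosen in terms
   of it. *)
exists (K1 + K2); first exact: addr_gt0.
move=> S T a b c a0 b0 c0 SP TP m.
have env0 r i : 0 <= env R r i by exact/ltW/env_gt0.
have sum_le r (g : nat -> nat) :
    \sum_(i < r) (size (block S i) * size (block T (g i)))%:R <=
    c * a * (\sum_(i < r) env R p i * env R q (g i)) +
    c * b * (\sum_(i < r) env R p' i * env R q (g i)).
  rewrite !mulr_sumr -big_split; apply: ler_sum => i _ /=.
  rewrite natrM (le_trans (ler_pM _ _ (SP i) (TP (g i))))//.
  by rewrite le_eqVlt; apply/orP; left; apply/eqP; ring.
have := size_block_prodset S T m; rewrite -(ler_nat R) => /le_trans; apply.
rewrite natrD !natr_sum.
apply: le_trans (lerD (sum_le _ (fun i => m - i)%N)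
                      (sum_le _ (fun i => m.-1 - i)%N)) _.
have h1 := ler_wpM2l (mulr_ge0 c0 a0) (K1P m).
have h2 := ler_wpM2l (mulr_ge0 c0 b0) (K2P m).
have h3 := mulr_ge0 (mulr_ge0 c0 a0) (mulr_ge0 (ltW K20) (env0 (p + q) m)).
have h4 := mulr_ge0 (mulr_ge0 c0 b0) (mulr_ge0 (ltW K10) (env0 (p' + q) m)).
rewrite !mulrDr in h1 h2 *; rewrite !mulrDl; lra.
Qed.

Lemma block_le (R : realType) (A : set nat) (p e : R) : 0 < p -> 0 < e ->
  (exists2 M : R, 0 < M &
    forall m, (size (block A m))%:R <= e * env R p m + M * env R (p / 2) m) ->
  exists2 C : R, 0 < C & forall m, (size (block A m))%:R <= C * env R p m.
Proof.
move=> p0 e0 [M M0 MP]; exists (e + M) => [|m]; first exact: addr_gt0.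
rewrite (le_trans (MP m))// mulrDl lerD// ler_wpM2l ?(ltW M0)//.
by rewrite /env ler_wpM2l ?exprn_ge0// ler_powR ?ler1n//; lra.
Qed.

Lemma block_prodpow_le (R : realType) (A : set nat) (p C : R) :
  0 < p -> 0 < C ->
  (forall m, (size (block A m))%:R <= C * env R p m) ->
  forall j, exists2 C' : R, 0 < C' &
    forall m, (size (block (prodpow A j.+1) m))%:R <= C' * env R (j.+1%:R * p) m.
Proof.
move=> p0 C0 AP; elim=> [|j [C' C'0 IHj]].
  by exists C => // m; rewrite prodpow1 mul1r.
have q0 : 0 < j.+1%:R * p by rewrite mulr_gt0.
have [K K0 KP] := block_prodset_le R p p (j.+1%:R * p) p0 p0 q0.
exists (K * C' * C); first by rewrite !mulr_gt0.
move=> m.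
have AP' i : (size (block A i))%:R <= C * env R p i + 0 * env R p i.
  by rewrite mul0r addr0.
have := KP _ _ _ _ _ (ltW C0) (lexx 0) (ltW C'0) AP' IHj m.
by rewrite mul0r addr0 mulrA -[X in env R (X + _)]mul1r -mulrDl nat1r.
Qed.

(** Only one factor [A] has to carry the small coefficient: the other [j + 1] factors enter through
    the plain upper bound [C'], and [e / (K * C')] compensates the constants. The loss of [p / 2] in
    the exponent of the error term passes unchanged through the convolution. *)
Lemma block_prodpow_small (R : realType) (A : set nat) (p : R) :
  0 < p ->
  (forall e, 0 < e -> exists2 M : R, 0 < M &
    forall m, (size (block A m))%:R <= e * env R p m + M * env R (p / 2) m) ->
  forall j e, 0 < e -> exists2 M : R, 0 < M &
    forall m, (size (block (prodpow A j.+2) m))%:R <=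
      e * env R (j.+2%:R * p) m + M * env R (j.+2%:R * p - p / 2) m.
Proof.
move=> p0 AP j e e0; have p20 : 0 < p / 2 by lra.
have [C C0 CP] := block_le R A p 1 p0 ltr01 (AP 1 ltr01).
have [C' C'0 C'P] := block_prodpow_le R A p C p0 C0 CP j.
have q0 : 0 < j.+1%:R * p by rewrite mulr_gt0.
have [K K0 KP] := block_prodset_le R p (p / 2) (j.+1%:R * p) p0 p20 q0.
have KC0 : 0 < K * C' by rewrite mulr_gt0.
have [M M0 MP] := AP (e / (K * C')) (divr_gt0 e0 KC0).
exists (K * C' * M) => [|m]; first by rewrite mulr_gt0.
have := KP _ _ _ _ _ (ltW (divr_gt0 e0 KC0)) (ltW M0) (ltW C'0) MP C'P m.
have -> : p + j.+1%:R * p = j.+2%:R * p by rewrite -(natr1 j.+1); ring.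
have -> : p / 2 + j.+1%:R * p = j.+2%:R * p - p / 2.
  by rewrite -(natr1 j.+1); field.
by rewrite mulrDr !mulrA [K * C' * e]mulrC mulrK ?unitfE ?gt_eqF.
Qed.

(** For [m >= N] the hypothesis is used at [X = 4 ^ (m + 1)], where [sqrt X = 2 ^ (m + 1)] and
    [ln X = (m + 1) ln 4]; the constant [e / 2 * ln 4 ^ (1 - p)] absorbs the surplus factors. The
    finitely many smaller blocks are covered by the error term, since [env] is at least 1. *)
Lemma block_small (R : realType) (A : set nat) (p : R) : 0 < p ->
  (forall C : R, 0 < C -> exists N : nat, forall X : nat, (N < X)%N ->
    (countA A X)%:R < C * Num.sqrt X%:R / ln X%:R `^ (1 - p)) ->
  forall e : R, 0 < e -> exists2 M : R, 0 < M &
    forall m, (size (block A m))%:R <= e * env R p m + M * env R (p / 2) m.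
Proof.
move=> p0 AP e e0.
have ln4 : 0 < ln 4 :> R by rewrite ln_gt0// ltr1n.
have [|N NP] := AP (e / 2 * ln 4 `^ (1 - p)).
  by rewrite mulr_gt0 ?powR_gt0//; lra.
exists (4 ^+ N.+1) => [|m]; first by rewrite exprn_gt0.
have env0 r : 0 <= env R r m by exact/ltW/env_gt0.
have [Nm|mN] := leqP N m; last first.
  rewrite -[leLHS]add0r; apply: lerD; first by rewrite mulr_ge0// ltW.
  apply: (@le_trans _ _ (4 ^+ N.+1)).
    rewrite -natrX ler_nat (leq_trans (size_block_le_countA _ _))//.
    by rewrite (leq_trans (countA_le _ _))// leq_exp2l// leqW.
  by rewrite ler_peMr ?exprn_ge0// env_ge1//; lra.
rewrite -[leLHS]addr0; apply: lerD; last by rewrite mulr_ge0// exprn_ge0.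
apply: (@le_trans _ _ (countA A (4 ^ m.+1))%:R).
  by rewrite ler_nat size_block_le_countA.
have NX : (N < 4 ^ m.+1)%N.
  by rewrite (leq_ltn_trans Nm)// (ltn_trans (ltnSn m))// ltn_expl.
apply: le_trans (ltW (NP _ NX)) _.
have -> : Num.sqrt (4 ^ m.+1)%:R = 2 ^+ m.+1 :> R.
  have -> : (4 ^ m.+1 = (2 ^ m.+1) ^ 2)%N by rewrite -expnM mulnC expnM.
  by rewrite !natrX sqrtr_sqr ger0_norm ?exprn_ge0.
rewrite natrX lnXn// -(mulr_natl (ln 4)) powRM ?(ltW ln4)// invfM /env /wt.
rewrite -[p - 1]opprB powRN exprS le_eqVlt; apply/orP; left; apply/eqP.
have : ln 4 `^ (1 - p) != 0 :> R by rewrite gt_eqF ?powR_gt0.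
have : m.+1%:R `^ (1 - p) != 0 :> R by rewrite gt_eqF ?powR_gt0.
by move=> ? ?; field; apply/andP.
Qed.

(** * Choice of the scale and contradiction *)

Lemma powR_natr_unbounded (R : realType) (r B : R) (N : nat) : 0 < r ->
  exists2 n, (N <= n)%N & B < n.+1%:R `^ r.
Proof.
move=> r0; pose B' := Num.max 0 B.
have [n] : exists n : nat, B' `^ r^-1 < n%:R.
  by exists (Num.truncn (B' `^ r^-1)).+1; exact: truncnS_gt.
move=> nB; exists (n + N)%N; first by rewrite leq_addl.
have B'0 : 0 <= B' by rewrite le_max lexx.
apply: (@le_lt_trans _ _ B'); first by rewrite le_max lexx orbT.
have -> : B' = (B' `^ r^-1) `^ r by rewrite -powRrM mulVf ?gt_eqF// powRr1.
by apply: gt0_ltr_powR; rewrite ?nnegrE ?powR_ge0// (lt_le_trans nB)// ler_nat; lia.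
Qed.

Theorem theorem1p1 (R : realType) (k l : nat) (A : set nat) :
  (1 <= l)%N -> (l <= k)%N -> (2 <= k)%N ->
  A `<=` [set n | (0 < n)%N] ->
  0 < lower_density R (sumset (prodpow A k) (prodpow A l)) ->
  exists C : R, 0 < C /\
    forall N : nat, exists X : nat, (N < X)%N /\
      C * Num.sqrt (X%:R) / (ln (X%:R : R)) `^ ((k + l - 2)%:R / (k + l)%:R)
        <= (countA A X)%:R.
Proof.
move=> l1 lk k2 A0 /lower_density_gt0[d d0 [N0 dP]].
apply: contrapT => /forallNP noC.
pose p : R := 2 / (k + l)%:R.
have kl0 : (0 : R) < (k + l)%:R by rewrite ltr0n; lia.
have p0 : 0 < p by rewrite divr_gt0.
have klp : k%:R * p + l%:R * p = 2.
  by rewrite -mulrDl -natrD mulrC divfK ?gt_eqF.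
have alphaE : (k + l - 2)%:R / (k + l)%:R = 1 - p.
  by rewrite natrB 1?mulrBl ?divff ?gt_eqF//; lia.
have small : forall e : R, 0 < e -> exists2 M : R, 0 < M &
    forall m, (size (block A m))%:R <= e * env R p m + M * env R (p / 2) m.
  apply: block_small => // C C0.
  have [N NP] : exists N, forall X, ~ ((N < X)%N /\
      C * Num.sqrt X%:R / ln (X%:R : R) `^ ((k + l - 2)%:R / (k + l)%:R)
        <= (countA A X)%:R).
    apply: contrapT => /forallNP noN; apply: (noC C); split=> // N.
    by have /existsNP[X /contrapT] := noN N; exists X.
  exists N => X NX; rewrite ltNge -alphaE; apply/negP => le_X.
  by apply: (NP X).
have [C1 C10 C1P] := block_le R A p 1 p0 ltr01 (small 1 ltr01).
have [C C0 CP] : exists2 C : R, 0 < C &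
    forall m, (size (block (prodpow A l) m))%:R <= C * env R (l%:R * p) m.
  by rewrite -(prednK l1); exact: block_prodpow_le C1P _.
(* Each use of [sum_env_le] costs a factor 4, so the main term will be [16 * C * e = d / 2] times
   [4 ^ n]. *)
pose e : R := d / (32 * C).
have e0 : 0 < e by rewrite divr_gt0// mulr_gt0.
have [M M0 MP] : exists2 M : R, 0 < M &
    forall m, (size (block (prodpow A k) m))%:R <=
      e * env R (k%:R * p) m + M * env R (k%:R * p - p / 2) m.
  have -> : k = k.-2.+2 by lia.
  exact: block_prodpow_small.
(* This [n] makes the error term [16 * C * M / (n + 1) ^ (p / 2)] less than [d / 2]. *)
have [n Nn nB] := powR_natr_unbounded R (p / 2) (32 * C * M / d) N0
  (divr_gt0 p0 (ltr0n R 2)).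
have count_le S (f : nat -> R) :
    (forall m, (size (block S m))%:R <= f m) ->
    (countA S (4 ^ n))%:R <= \sum_(m < n.+1) f m.
  move=> Sf; apply: (@le_trans _ _ (\sum_(m < n.+1) size (block S m))%:R).
    by rewrite ler_nat countA_le_sum_block.
  by rewrite natr_sum; apply: ler_sum => m _; exact: Sf.
have countl : (countA (prodpow A l) (4 ^ n))%:R <= C * (4 * env R (l%:R * p) n).
  apply: le_trans (count_le _ _ CP) _.
  by rewrite -mulr_sumr ler_wpM2l ?(ltW C0)// sum_env_le ?mulr_ge0 ?(ltW p0).
(* This keeps the exponent [k p - p / 2] nonnegative, as [sum_env_le] requires. *)
have kp : p <= k%:R * p by rewrite ler_peMl ?(ltW p0)// ler1n; lia.
have countk : (countA (prodpow A k) (4 ^ n))%:R <=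
    e * (4 * env R (k%:R * p) n) + M * (4 * env R (k%:R * p - p / 2) n).
  apply: le_trans (count_le _ _ MP) _; rewrite big_split/= -!mulr_sumr.
  by apply: lerD; rewrite ler_wpM2l ?(ltW e0) ?(ltW M0)// sum_env_le; lra.
have n4 : (N0 <= 4 ^ n)%N by rewrite (leq_trans Nn)// ltnW// ltn_expl.
have := dP _ n4; apply/negP; rewrite -ltNge.
have := countA_sumset (prodpow A k) (prodpow A l) (4 ^ n)
  (prodpow_gt0 _ _ A0) (prodpow_gt0 _ _ A0).
rewrite -(ler_nat R) => /le_lt_trans; apply.
rewrite natrM; apply: le_lt_trans (ler_pM _ _ countk countl) _ => //.
set y := n.+1%:R `^ (p / 2) in nB.
have y0 : 0 < y by rewrite powR_gt0.
(* As [k p + l p = 2], the two logarithmic weights cancel exactly; this is where the value of alpha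
   enters. *)
have wkl : wt R (k%:R * p) n * wt R (l%:R * p) n = 1.
  by rewrite wtM klp subrr powRr0.
have wkl' : wt R (k%:R * p - p / 2) n * wt R (l%:R * p) n = y^-1.
  by rewrite wtM -powRN; congr (_ `^ _); lra.
have four : (4 ^ n)%:R = 2 ^+ n * 2 ^+ n :> R.
  by rewrite natrX -exprMn -natrM.
rewrite [ltLHS](_ : _ = 16 * C * (4 ^ n)%:R *
    (e * (wt R (k%:R * p) n * wt R (l%:R * p) n) +
     M * (wt R (k%:R * p - p / 2) n * wt R (l%:R * p) n))); last first.
  by rewrite four /env; ring.
rewrite wkl wkl' mulr1 mulrAC ltr_pM2r ?ltr0n ?expn_gt0//.
have My : 16 * C * (M / y) < d / 2.
  rewrite !mulrA ltr_pdivrMr//; move: nB; rewrite ltr_pdivrMr//.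
  lra.
have eE : 16 * C * e = d / 2 by rewrite /e; field; rewrite gt_eqF.
rewrite mulrDr eE; lra.
Qed.
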